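(* Let $\mathbb{K}\in\{\mathbb{R},\mathbb{C}\}$, let $\mathcal{X}$ be a separable topological $\mathbb{K}$-vector space whose topological dual $\mathcal{X}^{\ast}$ separates the points of $\mathcal{X}$, and let $\mathcal{U}$ be a $0$-neighborhood in $\mathcal{X}$. Fix a countable dense set $(A_n)_{n\in\mathbb{N}}\subseteq\mathcal{X}$ and define on $\mathcal{U}^{\circ}$ the metric $d(\sigma_1,\sigma_2)=\sum_{n\in\mathbb{N}}\frac{2^{-n}}{1+\max_{\sigma\in\mathcal{U}^{\circ}}|\sigma(A_n)|}|(\sigma_1-\sigma_2)(A_n)|$, and for $U_1,U_2\in\mathbf{CU}_{\mathcal{U}}(\mathcal{X}^{\ast})$ the Hausdorff distance $\mathfrak{d}_H(U_1,U_2)=\max\{\max_{\sigma_1\in U_1}\min_{\sigma_2\in U_2}d(\sigma_1,\sigma_2),\ \max_{\sigma_2\in U_2}\min_{\sigma_1\in U_1}d(\sigma_1,\sigma_2)\}$. Then the family $\{\{U_2\in\mathbf{CU}_{\mathcal{U}}(\mathcal{X}^{\ast}):\mathfrak{d}_H(U_1,U_2)<r\}: r>0,\ U_1\in\mathbf{CU}_{\mathcal{U}}(\mathcal{X}^{\ast})\}$ is a basis of the weak*-Hausdorff hypertopology on $\mathbf{CU}_{\mathcal{U}}(\mathcal{X}^{\ast})$. Moreover, $\mathbf{CU}_{\mathcal{U}}(\mathcal{X}^{\ast})$ is compact and completely metrizable in the weak*-Hausdorff hypertopology.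
   Context: Topological vector spaces are Hausdorff. $\mathcal{X}^{\ast}$ carries the weak* topology. The absolute polar of $\mathcal{U}$ is $\mathcal{U}^{\circ}=\{\sigma\in\mathcal{X}^{\ast}:|\sigma(A)|\le1\ \forall A\in\mathcal{U}\}$ (a weak*-compact convex set). $\mathbf{CU}_{\mathcal{U}}(\mathcal{X}^{\ast})$ is the set of nonempty convex weak*-closed subsets of $\mathcal{X}^{\ast}$ contained in $\mathcal{U}^{\circ}$. The weak*-Hausdorff hypertopology is the topology generated by the extended pseudometrics $d_H^{(A)}(F,\tilde F)=\max\{\sup_{\sigma\in F}\inf_{\tilde\sigma\in\tilde F}|(\sigma-\tilde\sigma)(A)|,\ \sup_{\tilde\sigma\in\tilde F}\inf_{\sigma\in F}|(\sigma-\tilde\sigma)(A)|\}$, $A\in\mathcal{X}$. *)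

(* Defs.v *)
From mathcomp Require Import all_boot all_algebra.
From mathcomp Require Import all_classical all_reals all_analysis.
From mathcomp.real_closed Require Import complex.
Import GRing.Theory Num.Theory numFieldTopology.Exports.

Set Implicit Arguments.
Unset Strict Implicit.
Unset Printing Implicit Defensive.

Local Open Scope classical_set_scope.
Local Open Scope ring_scope.

Definition Kfield (R : realType) (b : bool) : numFieldType :=
  if b then (R : numFieldType) else ((R[i])%C : numFieldType).

Definition absK (R : realType) (b : bool) : Kfield R b -> R :=
  match b return Kfield R b -> R with
  | true => fun z => `|z|
  | false => fun z => complex.Re `|z|
  end.

Section Defs.
Variables (R : realType) (b : bool) (X : topologicalLmodType (Kfield R b)).
Local Notation K := (Kfield R b).
Local Notation T := {ptws X -> K}.

(* topological dual X^* : continuous K-linear functionals; as a subset of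
   {ptws X -> K}, its subspace topology is the weak* topology *)
Definition dual : set T :=
  [set f | (forall (a : K) (x y : X), f (a *: x + y) = a * f x + f y) /\
           continuous (f : X -> K)].

Definition weakstar_closed (F : set T) : Prop :=
  F `<=` dual /\ closed (F : set (subspace dual)).

Definition polar (U : set X) : set T :=
  [set s | dual s /\ forall x, U x -> `|s x| <= 1].

Definition convexK (F : set T) : Prop :=
  forall (s1 s2 : T), F s1 -> F s2 -> forall t : K, 0 <= t <= 1 ->
    F ((fun x => t * s1 x + (1 - t) * s2 x) : T).

Definition CU (U : set X) : set (set T) :=
  [set F | F !=set0 /\ convexK F /\ weakstar_closed F /\ F `<=` polar U].

Definition dHA (A : X) (F G : set T) : \bar R :=
  maxe (ereal_sup [set ereal_inf [set (absK (s A - t A))%:E | t in G] | s in F])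
       (ereal_sup [set ereal_inf [set (absK (s A - t A))%:E | s in F] | t in G]).

(* open sets of the weak*-Hausdorff hypertopology on CU_U(X^* ):
   topology generated by the family of extended pseudometrics d_H^(A) *)
Definition hyper_open (U : set X) (O : set (set T)) : Prop :=
  O `<=` CU U /\
  forall F, O F -> exists (s : seq X) (e : R), 0 < e /\
    [set G | CU U G /\ forall A, A \in s -> (dHA A F G < e%:E)%E] `<=` O.

Definition dmet (A : nat -> X) (U : set X) (s1 s2 : T) : R :=
  limn (fun N => \sum_(0 <= n < N)
    ((2 ^- n) / (1 + sup [set absK (s (A n)) | s in polar U]))
      * absK (s1 (A n) - s2 (A n))).

Definition dHaus (A : nat -> X) (U : set X) (U1 U2 : set T) : R :=
  Num.max (sup [set inf [set dmet A U s1 s2 | s2 in U2] | s1 in U1])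
          (sup [set inf [set dmet A U s1 s2 | s1 in U1] | s2 in U2]).

Definition hyper_ball (A : nat -> X) (U : set X) (U1 : set T) (r : R) :
  set (set T) := [set U2 | CU U U2 /\ dHaus A U U1 U2 < r].

Definition hyper_compact (U : set X) : Prop :=
  forall (I : Type) (O : I -> set (set T)),
    (forall i, hyper_open U (O i)) -> CU U `<=` \bigcup_(i in setT) O i ->
    exists J : set I, finite_set J /\ CU U `<=` \bigcup_(i in J) O i.

Definition hyper_completely_metrizable (U : set X) : Prop :=
  exists m : set T -> set T -> R,
    (forall F G, CU U F -> CU U G -> 0 <= m F G) /\
    (forall F G, CU U F -> CU U G -> (m F G = 0 <-> F = G)) /\
    (forall F G, CU U F -> CU U G -> m F G = m G F) /\
    (forall F G H, CU U F -> CU U G -> CU U H -> m F H <= m F G + m G H) /\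
    (forall O, O `<=` CU U ->
       (hyper_open U O <->
        forall F, O F -> exists r : R, 0 < r /\
          [set G | CU U G /\ m F G < r] `<=` O)) /\
    (forall u : nat -> set T, (forall n, CU U (u n)) ->
       (forall e : R, 0 < e -> exists N, forall p q, (N <= p)%N -> (N <= q)%N ->
          m (u p) (u q) < e) ->
       exists L, CU U L /\
         forall e : R, 0 < e -> exists N, forall n, (N <= n)%N -> m (u n) L < e).

End Defs.

(* Main.v *)
Require Import Defs.
From mathcomp Require Import all_boot all_algebra.
From mathcomp Require Import all_classical all_reals all_analysis.
From mathcomp.real_closed Require Import complex.
From mathcomp Require Import all_order finmap ring lra.
Import Order.TTheory.
Import GRing.Theory Num.Theory numFieldTopology.Exports.
Local Open Scope classical_set_scope.
Local Open Scope ring_scope.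

(** On the polar of [U] the metric [d] induces the weak* uniformity: a tail
    estimate bounds [d] by finitely many evaluations at the [A n], and
    equicontinuity together with density bounds every evaluation by [d].  Hence
    the Hausdorff distance controls each of the pseudometrics [dHA].
    Conversely, finitely many of the [dHA] control the Hausdorff distance: a
    point [s] of [F] has an almost nearest point [p] in [G] for the squared
    distance of the first [N] coordinates, convexity of [G] makes [s - p] a
    functional almost separating [s] from [G], and such functionals are
    evaluations at combinations of the [A i], of which a finite net suffices.
    Compactness: an ultrafilter of members of [CU U] converges in Hausdorff
    distance to its Kuratowski limit, because selections of its members converge
    by weak* compactness of the polar.  Completeness follows by applying this to
    an ultrafilter containing the tails of a Cauchy sequence. *)

Set Implicit Arguments.
Unset Strict Implicit.
Unset Printing Implicit Defensive.

(** * The scalar field *)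

Section Scalars.
Variable R : realType.

(** Norms in [Kfield R b] take values in that field itself. [iK] embeds the reals there and
    preserves and reflects the order, so facts on [absK] are inherited from facts on norms. *)
Definition iK (b : bool) : R -> Kfield R b :=
  match b return R -> Kfield R b with
  | true => id
  | false => fun x => (x%:C)%C
  end.

Definition reK (b : bool) : Kfield R b -> R :=
  match b return Kfield R b -> R with
  | true => id
  | false => @complex.Re R
  end.

Definition conjK (b : bool) : Kfield R b -> Kfield R b :=
  match b return Kfield R b -> Kfield R b with
  | true => id
  | false => @conjc R
  end.

Lemma iK_abs b (z : Kfield R b) : iK b (absK z) = `|z|.
Proof. by case: b z. Qed.

Lemma ler_iK b (x y : R) : (iK b x <= iK b y) = (x <= y).
Proof. by case: b => //=; rewrite lecR. Qed.

Lemma ltr_iK b (x y : R) : (iK b x < iK b y) = (x < y).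
Proof. by case: b => //=; rewrite ltcR. Qed.

Lemma iK_inj b : injective (iK b).
Proof. by case: b => //= x y []. Qed.

Lemma iKD b x y : iK b (x + y) = iK b x + iK b y.
Proof. by case: b => //=; rewrite rmorphD. Qed.

Lemma iKB b x y : iK b (x - y) = iK b x - iK b y.
Proof. by case: b => //=; rewrite rmorphB. Qed.

Lemma iKM b x y : iK b (x * y) = iK b x * iK b y.
Proof. by case: b => //=; rewrite rmorphM. Qed.

Lemma iK0 b : iK b 0 = 0. Proof. by case: b. Qed.
Lemma iK1 b : iK b 1 = 1. Proof. by case: b. Qed.

Lemma absK_ge0 b (z : Kfield R b) : 0 <= absK z.
Proof. by rewrite -(ler_iK b) iK_abs iK0. Qed.

Lemma absKD b (z w : Kfield R b) : absK (z + w) <= absK z + absK w.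
Proof. by rewrite -(ler_iK b) iKD !iK_abs ler_normD. Qed.

Lemma absKM b (z w : Kfield R b) : absK (z * w) = absK z * absK w.
Proof. by apply: (@iK_inj b); rewrite iKM !iK_abs normrM. Qed.

Lemma absKN b (z : Kfield R b) : absK (- z) = absK z.
Proof. by apply: (@iK_inj b); rewrite !iK_abs normrN. Qed.

Lemma absKBC b (z w : Kfield R b) : absK (z - w) = absK (w - z).
Proof. by rewrite -opprB absKN. Qed.

Lemma absK0 b : absK (0 : Kfield R b) = 0.
Proof. by apply: (@iK_inj b); rewrite iK_abs normr0 iK0. Qed.

Lemma absK_eq0 b (z : Kfield R b) : absK z = 0 -> z = 0.
Proof. by move=> z0; apply/eqP; rewrite -normr_eq0 -iK_abs z0 iK0. Qed.

Lemma absK_dist b (x y z : Kfield R b) :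
  absK (x - z) <= absK (x - y) + absK (y - z).
Proof. by apply: le_trans (absKD _ _); rewrite subrKA. Qed.

Lemma absK_i b (x : R) : absK (iK b x) = `|x|.
Proof.
apply: (@iK_inj b); rewrite iK_abs; case: b => //=.
by rewrite normc_def /= expr0n /= addr0 sqrtr_sqr.
Qed.

Lemma absKC (z : Kfield R false) :
  absK z = Num.sqrt (complex.Re z ^+ 2 + complex.Im z ^+ 2).
Proof. by case: z. Qed.

Lemma norm_le_hypot (x y : R) : `|x| <= Num.sqrt (x ^+ 2 + y ^+ 2).
Proof. by rewrite -sqrtr_sqr ler_wsqrtr// lerDl sqr_ge0. Qed.

Lemma hypot_le_normD (x y : R) : Num.sqrt (x ^+ 2 + y ^+ 2) <= `|x| + `|y|.
Proof.
rewrite -[leRHS]ger0_norm ?addr_ge0// -sqrtr_sqr ler_wsqrtr//.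
rewrite sqrrD !real_normK ?num_real// addrAC lerDl.
by rewrite mulrn_wge0// mulr_ge0.
Qed.

Lemma normRe_le (z : Kfield R false) : `|complex.Re z| <= absK z.
Proof. by rewrite absKC norm_le_hypot. Qed.

Lemma normIm_le (z : Kfield R false) : `|complex.Im z| <= absK z.
Proof. by rewrite absKC addrC norm_le_hypot. Qed.

Lemma reKD b (z w : Kfield R b) : reK (z + w) = reK z + reK w.
Proof. by case: b z w => //= [[? ?] [? ?]]. Qed.

Lemma reK0 b : reK (0 : Kfield R b) = 0. Proof. by case: b. Qed.

Lemma reKMi b (x : R) (z : Kfield R b) : reK (iK b x * z) = x * reK z.
Proof. by case: b z => //= [[? ?]] /=; rewrite mul0r subr0. Qed.

Lemma reK_le b (z : Kfield R b) : reK z <= absK z.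
Proof.
case: b z => z; first exact: ler_norm.
exact: le_trans (ler_norm _) (normRe_le z).
Qed.

(** The form [reK (conjK z * w)] is the real inner product of the scalar field, and [absK] is its
    norm. *)
Lemma reK_conjM b (z : Kfield R b) : reK (conjK z * z) = absK z ^+ 2.
Proof.
case: b z => z; first by rewrite /= real_normK ?num_real// expr2.
rewrite absKC sqr_sqrtr ?addr_ge0 ?sqr_ge0//.
by case: z => x y /=; ring.
Qed.

Lemma reK_conjC b (z w : Kfield R b) : reK (conjK z * w) = reK (conjK w * z).
Proof. by case: b z w => /=; [move=> *; rewrite mulrC|move=> [? ?] [? ?] /=; ring]. Qed.

Lemma conjKD b (z w : Kfield R b) : conjK (z + w) = conjK z + conjK w.
Proof. by case: b z w => //= z w; rewrite rmorphD. Qed.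

Lemma absK_conj b (z : Kfield R b) : absK (conjK z) = absK z.
Proof. by apply: (@iK_inj b); rewrite !iK_abs; case: b z => //= z; rewrite normcJ. Qed.

(** * Neighbourhoods, prime filters and finite nets of scalars *)

Lemma nbhsK b (z : Kfield R b) (B : set (Kfield R b)) :
  nbhs z B <-> exists2 e : R, 0 < e & [set w | absK (z - w) < e] `<=` B.
Proof.
split.
  move=> /nbhs_ballP [e e0 eB]; exists (absK e).
    by rewrite -(ltr_iK b) iK_abs iK0 gtr0_norm.
  move=> w /= zw; apply: eB; rewrite /ball /=.
  by rewrite -iK_abs -(gtr0_norm e0) -iK_abs ltr_iK.
move=> [e e0 eB]; apply/nbhs_ballP; exists (iK b e).
  by rewrite /= -(iK0 b) ltr_iK.
by move=> w; rewrite /ball /= -iK_abs ltr_iK => /eB.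
Qed.

(* The ultrafilter property in a form that passes to arbitrary direct images. *)
Definition prime_filter {T : Type} (G : set_system T) :=
  ProperFilter G /\ forall P, G P \/ G (~` P).

Lemma ultra_prime T (G : set_system T) : UltraFilter G -> prime_filter G.
Proof.
by move=> GU; split => [|P]; [exact: ultra_proper|exact: in_ultra_setVsetC].
Qed.

Lemma prime_image T T' (f : T -> T') (G : set_system T) :
  prime_filter G -> prime_filter (f @ G).
Proof.
move=> [GF GP]; split; first exact: fmap_proper_filter.
by move=> P; exact: GP (f @^-1` P).
Qed.

(** Compactness of [[-M, M]] yields a cluster point. If a ball around it were not in [G], its
    complement would be, which clustering forbids. *)
Lemma prime_cvgR (G : set_system R) (M : R) : prime_filter G ->
  G [set x | `|x| <= M] -> exists x, forall e, 0 < e -> G [set y | `|x - y| < e].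
Proof.
move=> [GF GP] GM.
have [|x [_ xcl]] := @segment_compact R (- M) M G GF.
  by apply: filterS GM => x /=; rewrite ler_norml in_itv.
exists x => e e0; have [//|GN] := GP [set y | `|x - y| < e].
have [y [/= ]] := xcl _ (ball x e) GN (nbhsx_ballx x e e0).
by rewrite -ball_normE.
Qed.

Lemma prime_cvgK b (G : set_system (Kfield R b)) (M : R) : prime_filter G ->
  G [set x | absK x <= M] ->
  exists x, forall e : R, 0 < e -> G [set y | absK (x - y) < e].
Proof.
case: b G => G PG GM; first exact: prime_cvgR PG GM.
have GF := PG.1.
have [|x Hx] := @prime_cvgR _ M (prime_image (@complex.Re R) PG).
  have sub : [set z : Kfield R false | absK z <= M] `<=`
      [set z : Kfield R false | `|complex.Re z| <= M].
    by move=> z; exact: le_trans (normRe_le z).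
  exact: filterS sub GM.
have [|y Hy] := @prime_cvgR _ M (prime_image (@complex.Im R) PG).
  have sub : [set z : Kfield R false | absK z <= M] `<=`
      [set z : Kfield R false | `|complex.Im z| <= M].
    by move=> z; exact: le_trans (normIm_le z).
  exact: filterS sub GM.
exists (x +i* y)%C => e e0.
have e20 : 0 < e / 2 by rewrite divr_gt0.
have GB : G ([set z : Kfield R false | `|x - complex.Re z| < e / 2] `&`
             [set z : Kfield R false | `|y - complex.Im z| < e / 2]).
  by apply: filterI; [exact: Hx|exact: Hy].
apply: filterS GB => -[u v] [/= xu yv].
by apply: le_lt_trans (hypot_le_normD _ _) _ => /=; lra.
Qed.

Lemma net_R (M e : R) : 0 < e -> exists l : seq R,
  forall x, `|x| <= M -> exists2 y, y \in l & `|x - y| < e.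
Proof.
move=> e0; have [M0|M0] := leP 0 M; last first.
  exists [::] => x xM; move: M0; rewrite ltNge => /negP; case; exact: le_trans xM.
(* A grid of mesh [e] starting at [- M]; the grid point just below [x] has an index of at most
   [2 * M / e] because [x <= M]. *)
exists [seq - M + e * k%:R | k <- iota 0 (Num.truncn (2 * M / e)).+1].
move=> x; rewrite ler_norml => /andP[Mx xM].
have xe : 0 <= (x + M) / e by apply: divr_ge0; [lra|exact: ltW].
exists (- M + e * (Num.truncn ((x + M) / e))%:R).
  apply/mapP; eexists; last reflexivity.
  rewrite mem_iota add0n ltnS /=; apply: le_truncn.
  by rewrite ler_pM2r ?invr_gt0//; lra.
have /andP[H1 H2] := truncn_itv xe.
rewrite ltr_norml; move: H1 H2.
rewrite ler_pdivlMr// ltr_pdivrMr// -natr1 => H1 H2.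
by apply/andP; split; lra.
Qed.

Lemma net_K b (M e : R) : 0 < e -> exists l : seq (Kfield R b),
  forall x, absK x <= M -> exists2 y, y \in l & absK (x - y) < e.
Proof.
case: b => e0; first exact: net_R.
have e20 : 0 < e / 2 by rewrite divr_gt0.
have [l Hl] := net_R M e20.
exists [seq (x +i* y)%C | x <- l, y <- l] => -[x y] xyM.
have [u ul xu] := Hl x (le_trans (normRe_le _) xyM).
have [v vl yv] := Hl y (le_trans (normIm_le _) xyM).
exists (u +i* v)%C; first by apply/allpairsP; exists (u, v).
by apply: le_lt_trans (hypot_le_normD _ _) _ => /=; lra.
Qed.

End Scalars.

(** * The metric on the polar *)

Section DyadicSeries.
Variable R : realType.

Lemma sum_dyadic (N M : nat) : (N <= M)%N ->
  \sum_(N <= k < M) (2 ^- k : R) = 2 * 2 ^- N - 2 * 2 ^- M.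
Proof.
elim: M => [|M IH]; first by rewrite leqn0 => /eqP ->; rewrite big_geq// subrr.
rewrite leq_eqVlt => /predU1P[->|]; first by rewrite big_geq// subrr.
rewrite ltnS => NM; rewrite big_nat_recr//= IH// exprS invfM mulVKf//.
by rewrite mulr2n mulrDl mul1r; lra.
Qed.

Lemma exists_dyadic_lt (e : R) : 0 < e -> exists N : nat, 2 ^- N < e.
Proof.
move=> e0; exists (Num.truncn e^-1).+1.
rewrite invf_plt ?posrE ?exprn_gt0//.
have /truncn_itv/andP[_ /lt_le_trans] : 0 <= e^-1 by rewrite invr_ge0 ltW.
by apply; rewrite -natrX ler_nat ltnW// ltn_expl.
Qed.

Variable u : R^nat.
Hypothesis u_dyadic : forall n, 0 <= u n <= 2 * 2 ^- n.

Lemma nondecreasing_series_dyadic : nondecreasing_seq (series u).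
Proof. by apply: nondecreasing_series => n _ _; have /andP[] := u_dyadic n. Qed.

(** The terms from [N] on are dominated by the geometric terms [2 * 2 ^- k], whose sums stay below
    [4 * 2 ^- N]. *)
Lemma series_dyadic_tail N M : series u M <= series u N + 4 * 2 ^- N.
Proof.
have [MN|/ltnW NM] := leqP M N.
  have /le_trans := nondecreasing_series_dyadic MN; apply.
  by rewrite lerDl mulr_ge0// invr_ge0 exprn_ge0.
rewrite -lerBlDl sub_series_geq//.
apply: (@le_trans _ _ (\sum_(N <= k < M) 2 * 2 ^- k)).
  by apply: ler_sum => k _; have /andP[] := u_dyadic k.
rewrite -mulr_sumr sum_dyadic//.
have : 0 <= 2 ^- M :> R by rewrite invr_ge0 exprn_ge0.
lra.
Qed.

Lemma cvg_series_dyadic : cvgn (series u).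
Proof.
apply: nondecreasing_is_cvgn; first exact: nondecreasing_series_dyadic.
exists (series u 0 + 4 * 2 ^- 0) => _ [M _ <-]; exact: series_dyadic_tail.
Qed.

Lemma series_dyadic_le_lim N : series u N <= limn (series u).
Proof.
exact: nondecreasing_cvgn_le nondecreasing_series_dyadic cvg_series_dyadic N.
Qed.

Lemma lim_series_dyadic_le N : limn (series u) <= series u N + 4 * 2 ^- N.
Proof.
apply: limr_le; first exact: cvg_series_dyadic.
by apply: nearW => M; exact: series_dyadic_tail.
Qed.

End DyadicSeries.

(** * Equicontinuity and pointwise boundedness of the polar *)

Section Polar.
Variables (R : realType) (b : bool) (X : topologicalLmodType (Kfield R b)).
Local Notation K := (Kfield R b).
Local Notation T := {ptws X -> K}.
Local Notation dualX := (@dual R b X).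
Variable U : set X.
Hypothesis U0 : nbhs (0 : X) U.

Lemma near_scale_sub (c : K) (x : X) : \forall y \near x, U (c *: (y - x)).
Proof.
have : (fun y : X => c *: (y - x)) @ x --> c *: (x - x).
  apply: (@continuous2_cvg _ _ _ _ _ _ _ _ (fun (a : K^o) (z : X) => a *: z)).
  - exact: (@scale_continuous _ X (c, x - x)).
  - exact: cvg_cst.
  - apply: (@continuous2_cvg _ _ _ _ _ _ _ _ (fun z w : X => z + w)).
    + exact: (@add_continuous X (x, - x)).
    + exact: cvg_id.
    + exact: cvg_cst.
by rewrite subrr scaler0; exact.
Qed.

Section Linear.
Variable s : T.
Hypothesis s_lin : forall (a : K) (x y : X), s (a *: x + y) = a * s x + s y.

Lemma lin0 : s 0 = 0.
Proof.
have := s_lin 1 0 0; rewrite scaler0 addr0 mul1r -[LHS]addr0.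
by move=> /addrI. Qed.

Lemma linZ a x : s (a *: x) = a * s x.
Proof. by have := s_lin a x 0; rewrite lin0 !addr0. Qed.

Lemma linD x y : s (x + y) = s x + s y.
Proof. by have := s_lin 1 x y; rewrite scale1r mul1r. Qed.

Lemma linB x y : s (x - y) = s x - s y.
Proof. by rewrite linD -scaleN1r linZ mulN1r. Qed.

(** A linear functional bounded on a neighbourhood of 0 is continuous. Membership of pointwise
    limits in the polar thus reduces to linearity and a bound. *)
Lemma linear_bounded_polar : (forall x, U x -> absK (s x) <= 1) -> polar U s.
Proof.
move=> sU; split; last by move=> x /sU; rewrite -iK_abs -(iK1 R b) ler_iK.
split=> // x B /nbhsK[e e0 eB].
rewrite nbhs_simpl /=; near=> y; apply: eB => /=.
(* The factor [2 / e] turns the bound 1 on [U] into [e / 2], strictly below [e]. *)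
have /sU : U (iK b (2 / e) *: (y - x)) by near: y; exact: near_scale_sub.
have e20 : 0 < 2 / e by rewrite divr_gt0.
rewrite linZ absKM absK_i linB absKBC gtr0_norm//.
by rewrite mulrAC ler_pdivrMr// mul1r => ?; lra.
Unshelve. all: by end_near. Qed.

End Linear.

Lemma polar_lin s : polar U s ->
  forall (a : K) (x y : X), s (a *: x + y) = a * s x + s y.
Proof. by move=> [[]]. Qed.

Lemma polar_le1 s x : polar U s -> U x -> absK (s x) <= 1.
Proof. by move=> [_ sU] /sU; rewrite -iK_abs -(iK1 R b) ler_iK. Qed.

(** Equicontinuity of the polar in quantitative form: the bound is the same for all [s]. *)
Lemma polar_approx (x y : X) (c : R) s : 0 < c -> polar U s ->
  U (iK b c *: (y - x)) -> absK (s y - s x) <= c^-1.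
Proof.
move=> c0 Us /(polar_le1 Us); rewrite linZ ?linB; do ?exact: polar_lin.
by rewrite absKM absK_i gtr0_norm// -ler_pdivlMl// mulr1.
Qed.

(** Scalar multiplication is continuous at 0, so [U] contains a nonzero multiple of [x]. *)
Lemma polar_bound (x : X) :
  exists2 M : R, 0 < M & forall s, polar U s -> absK (s x) <= M.
Proof.
have : \forall t \near (0 : K^o), U (t *: x).
  have : (fun t : K^o => t *: x) @ (0 : K^o) --> (0 : K) *: x.
    apply: (@continuous2_cvg _ _ _ _ (nbhs (0 : K^o)) (nbhs_filter _) _ _
      (fun (a : K^o) (z : X) => a *: z)).
    - exact: (@scale_continuous _ X (0, x)).
    - exact: cvg_id.
    - exact: cvg_cst.
  by rewrite scale0r; exact.
move=> /nbhsK[e e0 eU]; exists (2 / e); first by rewrite divr_gt0.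
move=> s Us; have : U (iK b (e / 2) *: x).
  by apply: eU; rewrite /= sub0r absKN absK_i gtr0_norm ?divr_gt0//; lra.
rewrite -[x in U (_ *: x)]subr0 => Ux.
have e20 : 0 < e / 2 by rewrite divr_gt0.
have := polar_approx e20 Us Ux.
by rewrite (lin0 (polar_lin Us)) subr0 invf_div.
Qed.

Lemma polar0 : polar U (cst 0 : T).
Proof.
apply: linear_bounded_polar => [a x y|x _]; first by rewrite /cst mulr0 addr0.
by rewrite /cst absK0.
Qed.

(** * The metric [dmet] and the weak* topology on the polar *)

Variable A : nat -> X.
Hypothesis A_dense : dense (range A).

Definition weight n : R := 2 ^- n / (1 + sup [set absK (s (A n)) | s in polar U]).

Lemma sup_polar_ge n s : polar U s ->
  absK (s (A n)) <= sup [set absK (s (A n)) | s in polar U].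
Proof.
move=> Us; apply: sup_upper_bound; last by exists s.
split; first by exists (absK (s (A n))); exists s.
by have [M _ HM] := polar_bound (A n); exists M => _ [r Ur <-]; exact: HM.
Qed.

Lemma sup_polar_ge0 n : 0 <= sup [set absK (s (A n)) | s in polar U].
Proof. exact: le_trans (absK_ge0 _) (sup_polar_ge n polar0). Qed.

Lemma weight_gt0 n : 0 < weight n.
Proof. by rewrite divr_gt0 ?invr_gt0 ?exprn_gt0// ltr_pwDl ?sup_polar_ge0. Qed.

Lemma weight_le n : weight n <= 2 ^- n.
Proof.
by rewrite ler_pdivrMr ?ltr_pwDl ?sup_polar_ge0// ler_peMr ?invr_ge0 ?exprn_ge0//
  lerDl sup_polar_ge0.
Qed.

Local Notation d := (dmet A U).
Local Notation du s t := (fun n => weight n * absK (s (A n) - t (A n))).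

Lemma dmetE s t : d s t = limn (series (du s t)).
Proof. by []. Qed.

(** Two elements of the polar differ at [A n] by at most twice the supremum in the denominator of
    [weight n]. *)
Lemma dmet_dyadic s t : polar U s -> polar U t ->
  forall n, 0 <= du s t n <= 2 * 2 ^- n.
Proof.
move=> Us Ut n; apply/andP; split.
  by apply: mulr_ge0; [exact/ltW/weight_gt0|exact: absK_ge0].
have S0 := sup_polar_ge0 n; rewrite /weight.
set S := sup _ in S0 *.
have S1 : 0 < 1 + S by lra.
rewrite mulrAC ler_pdivrMr// [2 * _]mulrC -mulrA ler_pM2l ?invr_gt0 ?exprn_gt0//.
apply: le_trans (absKD _ _) _; rewrite absKN.
have := sup_polar_ge n Us; have := sup_polar_ge n Ut; rewrite -/S; lra.
Qed.

Lemma dmet_ge0 s t : polar U s -> polar U t -> 0 <= d s t.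
Proof.
move=> Us Ut; apply: le_trans (series_dyadic_le_lim (dmet_dyadic Us Ut) 0).
by rewrite /series /= big_geq.
Qed.

Lemma dmet_sym s t : d s t = d t s.
Proof.
by rewrite !dmetE; congr (limn (series _)); apply/funext => n; rewrite absKBC.
Qed.

Lemma dmet_self s : polar U s -> d s s = 0.
Proof.
move=> Us; rewrite dmetE (_ : series _ = cst 0) ?lim_cst//.
apply/funext => N; rewrite /series /= big1// => n _.
by rewrite subrr absK0 mulr0.
Qed.

(** Every partial sum of [d] is a seminorm of the difference of its arguments. The estimate serves
    the convexity of limits of convex sets. *)
Lemma dmet_lin_le (t u : K) s1 s2 r1 r2 :
  polar U s1 -> polar U s2 -> polar U r1 -> polar U r2 ->
  let s : T := fun x => t * s1 x + u * s2 x in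
  let r : T := fun x => t * r1 x + u * r2 x in
  polar U s -> polar U r -> d s r <= absK t * d s1 r1 + absK u * d s2 r2.
Proof.
move=> Us1 Us2 Ur1 Ur2 s r Us Ur.
apply: limr_le; first exact: cvg_series_dyadic (dmet_dyadic Us Ur).
apply: nearW => N.
apply: (@le_trans _ _ (absK t * series (du s1 r1) N + absK u * series (du s2 r2) N)).
  rewrite /series/= !mulr_sumr -big_split; apply: ler_sum => n _ /=.
  rewrite [leRHS](_ : _ = weight n * (absK t * absK (s1 (A n) - r1 (A n)) +
     absK u * absK (s2 (A n) - r2 (A n)))); last by ring.
  rewrite ler_pM2l ?weight_gt0// -!absKM.
  by apply: le_trans (absKD _ _); rewrite !mulrBr /s /r addrACA opprD.
by apply: lerD; apply: ler_wpM2l; rewrite ?absK_ge0//;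
  apply: series_dyadic_le_lim; exact: dmet_dyadic.
Qed.

Lemma dmet_triangle s t r : polar U s -> polar U t -> polar U r ->
  d s r <= d s t + d t r.
Proof.
move=> Us Ut Ur.
apply: limr_le; first exact: cvg_series_dyadic (dmet_dyadic Us Ur).
apply: nearW => N.
apply: (@le_trans _ _ (series (du s t) N + series (du t r) N)).
  rewrite /series/= -big_split; apply: ler_sum => n _ /=.
  by rewrite -mulrDr ler_pM2l ?weight_gt0// absK_dist.
by apply: lerD; apply: series_dyadic_le_lim; exact: dmet_dyadic.
Qed.

Lemma dmet_le4 s t : polar U s -> polar U t -> d s t <= 4.
Proof.
move=> Us Ut; apply: le_trans (lim_series_dyadic_le (dmet_dyadic Us Ut) 0) _.
by rewrite /series /= big_geq// expr0 invr1 mulr1 add0r.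
Qed.

Lemma dmet_ge_term n s t : polar U s -> polar U t ->
  weight n * absK (s (A n) - t (A n)) <= d s t.
Proof.
move=> Us Ut; have D := dmet_dyadic Us Ut.
apply: le_trans (series_dyadic_le_lim D n.+1).
rewrite /series /= big_nat_recr//= lerDr.
by apply: sumr_ge0 => k _; have /andP[] := D k.
Qed.

Lemma dmet_lt_of_coords (e : R) : 0 < e -> exists (N : nat) (delta : R), 0 < delta /\
  forall s t, polar U s -> polar U t ->
    (forall i, (i < N)%N -> absK (s (A i) - t (A i)) <= delta) -> d s t < e.
Proof.
(* This [N] makes the tail [4 * 2 ^- N] less than [e / 2]; with coordinates within [e / 8], the head
   is at most [2 * (e / 8)]. *)
move=> e0; have [|N HN] := @exists_dyadic_lt R (e / 8); first by rewrite divr_gt0.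
exists N, (e / 8); split; first by rewrite divr_gt0.
move=> s t Us Ut H; have D := dmet_dyadic Us Ut.
apply: le_lt_trans (lim_series_dyadic_le D N) _.
suff : series (du s t) N <= e / 4 by lra.
apply: (@le_trans _ _ (\sum_(0 <= k < N) 2 ^- k * (e / 8))).
  rewrite /series /= big_nat_cond [leRHS]big_nat_cond; apply: ler_sum => k.
  rewrite andbT => /andP[_ kN]; apply: ler_pM => //; last exact: H.
  - exact/ltW/weight_gt0.
  - exact: absK_ge0.
  - exact: weight_le.
rewrite -mulr_suml sum_dyadic// expr0 invr1 mulr1.
have : 0 <= 2 ^- N :> R by rewrite invr_ge0 exprn_ge0.
nra.
Qed.

(* Uniformity in [s] and [t] comes from equicontinuity of the polar: [x] is
   approximated by some [A n]. *)
Lemma eval_unif_continuous (x : X) (e : R) : 0 < e -> exists2 r : R, 0 < r &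
  forall s t, polar U s -> polar U t -> d s t < r -> absK (s x - t x) < e.
Proof.
(* At scale [4 / e], both [s] and [t] vary by at most [e / 4] between [x] and [A n]; the radius
   chosen below keeps their difference at [A n] under [e / 4]. *)
move=> e0; have c0 : 0 < 4 / e by rewrite divr_gt0.
have Hx : nbhs x [set y | U (iK b (4 / e) *: (y - x))] := near_scale_sub _ _.
have [y [Uy [n _ An]]] := A_dense
  (ex_intro _ x (nbhs_singleton (nbhs_interior Hx))) (@open_interior _ _).
have Un : U (iK b (4 / e) *: (A n - x)) by rewrite An; exact: interior_subset Uy.
exists (weight n * (e / 4)); first by rewrite mulr_gt0 ?weight_gt0 ?divr_gt0.
move=> s t Us Ut /(le_lt_trans (dmet_ge_term n Us Ut)).
rewrite ltr_pM2l ?weight_gt0// => st.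
have := polar_approx c0 Us Un; have := polar_approx c0 Ut Un.
rewrite invf_div => Ht; rewrite absKBC => Hs.
have := absK_dist (s x) (s (A n)) (t x).
have := absK_dist (s (A n)) (t (A n)) (t x); lra.
Qed.

(** The Banach-Alaoglu theorem for prime filters: values converge at each point, the limit inherits
    linearity and the bound on [U], and finitely many coordinates control [d]. *)
Lemma polar_prime_cvg (G : set_system T) : prime_filter G -> G (polar U) ->
  exists2 t, polar U t & forall e, 0 < e -> G [set s | polar U s /\ d t s < e].
Proof.
move=> PG GU; have GF := PG.1.
have /choice[t Ht] : forall x : X, exists z : K, forall e : R, 0 < e ->
    G [set s : T | absK (z - s x) < e].
  move=> x; have [M M0 HM] := polar_bound x.
  have [|z Hz] := @prime_cvgK _ _ _ M (prime_image (fun s : T => s x) PG).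
    by apply: (@filterS _ G _ _ _ _ GU) => s; exact: HM.
  by exists z.
have Ut : polar U t.
  apply: linear_bounded_polar => [a x y|x Ux].
    apply/eqP; rewrite -subr_eq0; apply/eqP/absK_eq0/eqP.
    rewrite eq_le absK_ge0 andbT; apply/ler_addgt0Pr => e e0; rewrite add0r.
    have ca : 0 < absK a + 2 by have := absK_ge0 a; lra.
    (* The defect of linearity has two errors below [c] and one scaled by [absK a], hence at most
       [e] in total. *)
    pose c := e / (absK a + 2).
    have c0 : 0 < c by rewrite divr_gt0.
    have [s [Us [H1 [H2 H3]]]] : exists s : T, polar U s /\
      absK (t (a *: x + y) - s (a *: x + y)) < c /\ absK (t x - s x) < c /\
      absK (t y - s y) < c.
      have [s [[[? ?] ?] ?]] := @filter_ex _ G _ _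
        (filterI (filterI (filterI GU (Ht x _ c0)) (Ht y _ c0))
                 (Ht (a *: x + y) _ c0)).
      by exists s.
    rewrite (_ : _ - _ = (t (a *: x + y) - s (a *: x + y)) +
      (- (a * (t x - s x)) - (t y - s y))); last by rewrite (polar_lin Us); ring.
    apply: le_trans (absKD _ _) _.
    have := absKD (- (a * (t x - s x))) (- (t y - s y)).
    rewrite !absKN absKM.
    have : absK a * absK (t x - s x) <= absK a * c.
      by apply: ler_wpM2l; [exact: absK_ge0|exact: ltW].
    have : c * (absK a + 2) = e by rewrite /c divfK// gt_eqF.
    lra.
  apply/ler_addgt0Pr => e e0.
  have [s [Us st]] := @filter_ex _ G _ _ (filterI GU (Ht x _ e0)).
  have := polar_le1 Us Ux; have := absK_dist (t x) (s x) 0.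
  by rewrite !subr0 /= in st *; lra.
exists t => // e e0.
have [N [c [c0 H]]] := dmet_lt_of_coords e0.
have : \forall s \near G, forall i : 'I_N, absK (t (A i) - s (A i)) < c.
  by apply: filter_forall => i; exact: Ht.
move=> /(filterI GU); apply: filterS => s [Us Hs]; split => //.
by apply: H => // i iN; exact/ltW/(Hs (Ordinal iN)).
Qed.

Lemma cylinder_nbhs (t : T) (x : X) (e : R) : 0 < e ->
  nbhs t [set s : T | absK (t x - s x) < e].
Proof.
move=> e0; have tB : nbhs (t x) [set w | absK (t x - w) < e].
  by apply/nbhsK; exists e.
exact: (@proj_continuous _ (fun _ : X => K) x t _ tB).
Qed.

(** The traces on [F] of the [d]-balls around [t] generate a filter. Evaluations are uniformly
    continuous for [d], so it converges pointwise to [t]. *)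
Lemma weakstar_closed_dclosed (F : set T) (t : T) :
  weakstar_closed F -> F `<=` polar U -> polar U t ->
  (forall e, 0 < e -> exists2 s, F s & d t s < e) -> F t.
Proof.
move=> [Fd /closed_subspaceP[V clV VF]] FU Ut Ht.
suff : (V `&` dualX) t by rewrite VF => -[].
split; last by have [] := Ut.
apply: clV.
pose G := filter_from [set e : R | 0 < e] (fun e => [set s | F s /\ d t s < e]).
have GF : ProperFilter G.
  apply: filter_from_proper; last by move=> e /= /Ht[s Fs ts]; exists s.
  apply: filter_from_filter; first by exists 1 => /=.
  move=> e1 e2 /= e10 e20; exists (Num.min e1 e2); first by rewrite lt_min e10.
  by move=> s /= [Fs]; rewrite lt_min => /andP[].
have Gt : {ptws, G --> t}.
  apply/pointwise_cvgP => x B /nbhsK[e e0 eB].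
  have [r r0 Hr] := eval_unif_continuous x e0.
  exists r => // s [Fs ts]; apply: eB => /=; apply: Hr => //; exact: FU.
move=> B /Gt GB; have [s [Bs Fs]] : (B `&` F) !=set0.
  apply: (@filter_ex _ G); apply: filterI GB _.
  by exists 1 => /= [|s []].
exists s; split=> //.
suff : (V `&` dualX) s by case.
by rewrite VF; split => //; exact: Fd.
Qed.

Lemma dclosed_weakstar_closed (F : set T) : F `<=` polar U ->
  (forall t, polar U t -> (forall e, 0 < e -> exists2 s, F s & d t s < e) -> F t) ->
  weakstar_closed F.
Proof.
move=> FU Fcl; have Fd : F `<=` dualX by move=> s /FU[].
(* The closure is taken in the whole product space; its points that lie in the dual are in the polar
   and are [d]-limits of points of [F]. *)
split => //; apply/closed_subspaceP; exists (closure F).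
  exact: closed_closure.
apply/seteqP; split=> t [Ft dt]; split=> //; last exact: subset_closure.
have near_F (P : set T) : nbhs t P -> exists2 s, F s & P s.
  by move=> /Ft[s [Fs Ps]]; exists s.
have Ut : polar U t.
  apply: linear_bounded_polar => [|x Ux]; first exact: dt.1.
  apply/ler_addgt0Pr => e e0.
  have [s Fs /= ts] := near_F _ (cylinder_nbhs t x e0).
  have := polar_le1 (FU _ Fs) Ux; have := absK_dist (t x) (s x) 0.
  by rewrite !subr0; lra.
apply: (Fcl _ Ut) => e e0; have [N [c [c0 H]]] := dmet_lt_of_coords e0.
have /near_F[s Fs ts] : \forall s \near t, forall i : 'I_N, absK (t (A i) - s (A i)) < c.
  by apply: (@filter_forall _ _ _ (nbhs t) _) => i; exact: cylinder_nbhs.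
exists s => //; apply: H => //; first exact: FU.
by move=> i iN; exact/ltW/(ts (Ordinal iN)).
Qed.

End Polar.

(** * Hausdorff distance and separation *)

(** Expansion of the squared norm along a real segment, for the variational argument in
    [separation_net]. *)
Lemma absK_subZ_sqr (R : realType) b (l : R) (z w : Kfield R b) :
  absK (z - iK b l * w) ^+ 2 =
    absK z ^+ 2 - 2 * l * reK (conjK z * w) + l ^+ 2 * absK w ^+ 2.
Proof.
have E (x y : Kfield R b) : absK (x + y) ^+ 2 =
    absK x ^+ 2 + 2 * reK (conjK x * y) + absK y ^+ 2.
  rewrite -!reK_conjM conjKD mulrDl !mulrDr !reKD (reK_conjC y x); ring.
rewrite E absKN absKM absK_i exprMn real_normK ?num_real//.
have -> : - (iK b l * w) = iK b (- l) * w.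
  by rewrite -mulNr -[- l]add0r iKB iK0 sub0r.
by rewrite mulrCA reKMi; ring.
Qed.

Section Hausdorff.
Variables (R : realType) (b : bool) (X : topologicalLmodType (Kfield R b)).
Local Notation K := (Kfield R b).
Local Notation T := {ptws X -> K}.
Variable U : set X.
Hypothesis U0 : nbhs (0 : X) U.
Variable A : nat -> X.
Hypothesis A_dense : dense (range A).
Local Notation d := (dmet A U).
Local Notation dH := (dHaus A U).

Lemma CU_polar F : CU U F -> F `<=` polar U. Proof. by case=> _ [_ [_]]. Qed.

Lemma CU_neq0 F : CU U F -> F !=set0. Proof. by case. Qed.

Definition dist_set (s : T) (G : set T) : R := inf [set d s t | t in G].

(** Symmetry of [dmet] makes the two halves of [dHaus] one expression with the sets exchanged, so
    that later arguments treat a single half. *)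
Lemma dHausE F G :
  dH F G = Num.max (sup [set dist_set s G | s in F]) (sup [set dist_set t F | t in G]).
Proof.
congr (Num.max _ (sup _)); apply/seteqP; split=> _ [t Gt <-]; exists t => //;
  rewrite /dist_set; congr (inf _); apply/seteqP; split=> _ [s Fs <-]; exists s => //;
  exact: dmet_sym.
Qed.

Lemma dHaus_sym F G : dH F G = dH G F.
Proof. by rewrite !dHausE maxC. Qed.

Lemma has_inf_dmet s G : polar U s -> CU U G -> has_inf [set d s t | t in G].
Proof.
move=> Us CG; split; first by have [t Gt] := CU_neq0 CG; exists (d s t); exists t.
exists 0 => _ [t Gt <-]; apply: dmet_ge0 => //; exact: CU_polar CG _ Gt.
Qed.

Lemma dist_set_le s t G : polar U s -> CU U G -> G t -> dist_set s G <= d s t.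
Proof.
by move=> Us CG Gt; apply: ge_inf; [exact: (has_inf_dmet Us CG).2|exists t].
Qed.

Lemma dist_set_ltP s G r : polar U s -> CU U G -> dist_set s G < r ->
  exists2 t, G t & d s t < r.
Proof.
move=> Us CG /(inf_lt (has_inf_dmet Us CG).1) [_ [t Gt <-] str].
by exists t.
Qed.

Lemma dist_set_le_dHaus s F G : CU U F -> CU U G -> F s -> dist_set s G <= dH F G.
Proof.
move=> CF CG Fs; rewrite dHausE le_max; apply/orP; left.
apply: sup_upper_bound; last by exists s.
split; first by exists (dist_set s G); exists s.
(* The bound 4 on [d] over the polar makes this real supremum one of a bounded set. *)
have [t Gt] := CU_neq0 CG; exists 4 => _ [r Fr <-].
have Ur := CU_polar CF Fr; apply: le_trans (dist_set_le Ur CG Gt) _.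
by apply: dmet_le4 => //; exact: CU_polar CG _ Gt.
Qed.

Lemma dHaus_ltP s F G r : CU U F -> CU U G -> dH F G < r -> F s ->
  exists2 t, G t & d s t < r.
Proof.
move=> CF CG FGr Fs; apply: dist_set_ltP => //; first exact: CU_polar CF _ Fs.
exact: le_lt_trans (dist_set_le_dHaus CF CG Fs) FGr.
Qed.

Lemma dHaus_le F G r : CU U F -> CU U G ->
  (forall s, F s -> exists2 t, G t & d s t <= r) ->
  (forall t, G t -> exists2 s, F s & d t s <= r) -> dH F G <= r.
Proof.
have H F' G' : CU U F' -> CU U G' ->
    (forall s, F' s -> exists2 t, G' t & d s t <= r) ->
    sup [set dist_set s G' | s in F'] <= r.
  move=> CF CG FG; apply: ge_sup.
    by have [s Fs] := CU_neq0 CF; exists (dist_set s G'); exists s.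
  move=> _ [s Fs <-]; have [t Gt] := FG s Fs; apply: le_trans.
  by apply: dist_set_le => //; exact: CU_polar CF _ Fs.
by move=> CF CG FG GF; rewrite dHausE ge_max !H.
Qed.

Lemma dHaus_ge0 F G : CU U F -> CU U G -> 0 <= dH F G.
Proof.
move=> CF CG; have [s Fs] := CU_neq0 CF.
apply: le_trans (dist_set_le_dHaus CF CG Fs).
apply: lb_le_inf; first exact: (has_inf_dmet (CU_polar CF Fs) CG).1.
move=> _ [t Gt <-]; apply: dmet_ge0 => //; [exact: CU_polar CF _ Fs|exact: CU_polar CG _ Gt].
Qed.

Lemma dHaus_self F : CU U F -> dH F F = 0.
Proof.
move=> CF; apply/eqP; rewrite eq_le dHaus_ge0// andbT.
by apply: dHaus_le => // s Fs; exists s => //; rewrite dmet_self//; exact: CU_polar CF _ Fs.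
Qed.

Lemma dHaus_triangle F G H : CU U F -> CU U G -> CU U H ->
  dH F H <= dH F G + dH G H.
Proof.
move=> CF CG CH; apply/ler_addgt0Pr => e e0.
have lt1 F' G' : dH F' G' < dH F' G' + e / 2 by rewrite ltrDl divr_gt0.
apply: dHaus_le => //.
- move=> s Fs; have [t Gt st] := dHaus_ltP CF CG (lt1 _ _) Fs.
  have [r Hr tr] := dHaus_ltP CG CH (lt1 _ _) Gt; exists r => //.
  have := dmet_triangle U0 A (CU_polar CF Fs) (CU_polar CG Gt) (CU_polar CH Hr).
  lra.
- move=> r Hr; have [t Gt st] := dHaus_ltP CH CG (lt1 _ _) Hr.
  have [s Fs tr] := dHaus_ltP CG CF (lt1 _ _) Gt; exists s => //.
  have := dmet_triangle U0 A (CU_polar CH Hr) (CU_polar CG Gt) (CU_polar CF Fs).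
  by move: st tr; rewrite (dHaus_sym H G) (dHaus_sym G F); lra.
Qed.

(** Each point of one set is at distance 0 from the other, which is closed for [d]. *)
Lemma dHaus_eq0 F G : CU U F -> CU U G -> dH F G = 0 -> F = G.
Proof.
have sub F' G' : CU U F' -> CU U G' -> dH F' G' = 0 -> F' `<=` G'.
  move=> CF CG FG0 s Fs.
  apply: (weakstar_closed_dclosed U0 A_dense CG.2.2.1 (CU_polar CG) (CU_polar CF Fs)).
  by move=> e e0; apply: (dHaus_ltP CF CG _ Fs); rewrite FG0.
by move=> CF CG FG0; apply/seteqP; split; apply: sub => //; rewrite dHaus_sym.
Qed.

(** * Mutual control of the pseudometrics [dHA] and the Hausdorff distance *)

Lemma dHA_sym (x : X) (F G : set T) : dHA x F G = dHA x G F.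
Proof.
rewrite /dHA maxC; congr (maxe (ereal_sup _) (ereal_sup _));
apply/seteqP; split=> _ [t Gt <-]; exists t => //;
  congr (ereal_inf _); apply/seteqP; split=> _ [s Fs <-]; exists s => //;
  by rewrite absKBC.
Qed.

Lemma dHA_ltP (x : X) (F G : set T) (e : R) (s : T) : (dHA x F G < e%:E)%E -> F s ->
  exists2 t, G t & absK (s x - t x) < e.
Proof.
rewrite /dHA gt_max => /andP[FG _] Fs.
have /ereal_inf_lt[_ [t Gt <-]] : (ereal_inf [set (absK (s x - t x))%:E | t in G] < e%:E)%E.
  by apply: le_lt_trans FG; apply: ereal_sup_ubound; exists s.
by rewrite lte_fin => st; exists t.
Qed.

Lemma dHA_le (x : X) (F G : set T) (e : R) :
  (forall s, F s -> exists2 t, G t & absK (s x - t x) <= e) ->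
  (forall t, G t -> exists2 s, F s & absK (t x - s x) <= e) ->
  (dHA x F G <= e%:E)%E.
Proof.
have H (F' G' : set T) :
    (forall s, F' s -> exists2 t, G' t & absK (s x - t x) <= e) ->
    (ereal_sup [set ereal_inf [set (absK (s x - t x))%:E | t in G'] | s in F'] <= e%:E)%E.
  move=> FG; apply: ge_ereal_sup => _ [s Fs <-]; have [t Gt st] := FG s Fs.
  apply: (@le_trans _ _ (absK (s x - t x))%:E); last by rewrite lee_fin.
  by apply: ereal_inf_lbound; exists t.
move=> FG GF; rewrite [dHA _ _ _]/dHA ge_max H//=.
have := H _ _ GF; congr (_ <= _)%E; congr ereal_sup.
apply/seteqP; split=> _ [t Gt <-]; exists t => //;
  congr (ereal_inf _); apply/seteqP; split=> _ [s Fs <-]; exists s => //;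
  by rewrite absKBC.
Qed.

Lemma dHaus_small_dHA_small (l : seq X) (e : R) : 0 < e -> exists2 r, 0 < r &
  forall F G, CU U F -> CU U G -> dH F G < r ->
    forall x, x \in l -> (dHA x F G < e%:E)%E.
Proof.
move=> e0; elim: l => [|x l [r r0 IH]]; first by exists 1.
have e20 : 0 < e / 2 by rewrite divr_gt0.
have [r' r'0 H] := eval_unif_continuous U0 A_dense x e20.
exists (Num.min r r'); first by rewrite lt_min r0.
move=> F G CF CG; rewrite lt_min => /andP[FGr FGr'] y.
rewrite inE => /predU1P[->|]; last exact: IH.
apply: (@le_lt_trans _ _ (e / 2)%:E); last by rewrite lte_fin; lra.
apply: dHA_le => [s Fs|t Gt].
  have [t Gt st] := dHaus_ltP CF CG FGr' Fs; exists t => //; apply/ltW/H => //.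
    exact: CU_polar CF _ Fs.
  exact: CU_polar CG _ Gt.
have GFr' : dH G F < r' by rewrite dHaus_sym.
have [s Fs ts] := dHaus_ltP CG CF GFr' Gt; exists s => //; apply/ltW/H => //.
  exact: CU_polar CG _ Gt.
exact: CU_polar CF _ Fs.
Qed.

(** The polar is bounded at each [A i], so coefficients can be rounded to a finite net with an error
    uniform in [s]. The net is built one coordinate at a time. *)
Lemma combination_net (N : nat) (D c : R) : 0 < c -> exists l : seq X,
  forall k : nat -> K, (forall i, (i < N)%N -> absK (k i) <= D) ->
    exists2 x, x \in l & forall s, polar U s ->
      absK (s x - \sum_(0 <= i < N) k i * s (A i)) <= c.
Proof.
elim: N c => [|N IH] c c0.
  exists [:: 0] => k _; exists 0; first by rewrite inE.
  by move=> s Us; rewrite big_geq// (lin0 (polar_lin Us)) subr0 absK0 ltW.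
have c20 : 0 < c / 2 by rewrite divr_gt0.
have [l Hl] := IH _ c20.
have [M M0 HM] := polar_bound U0 (A N).
(* The bound [M] at [A N] turns this mesh into an error of at most [c / 2]. *)
have [l' Hl'] := @net_K R b D (c / 2 / M) (divr_gt0 c20 M0).
exists [seq x + z *: A N | x <- l, z <- l'] => k kD.
have [i iN|x xl Hx] := Hl k; first by apply: kD; rewrite ltnW.
have [z zl kz] := Hl' (k N) (kD N (ltnSn N)).
exists (x + z *: A N); first by apply/allpairsP; exists (x, z).
move=> s Us; rewrite big_nat_recr//= (linD (polar_lin Us)) (linZ (polar_lin Us)).
rewrite (_ : _ - _ = (s x - \sum_(0 <= i < N) k i * s (A i)) - (k N - z) * s (A N));
  last by ring.
apply: le_trans (absKD _ _) _; rewrite absKN absKM.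
have := Hx s Us.
suff : absK (k N - z) * absK (s (A N)) <= c / 2 by lra.
apply: (@le_trans _ _ (c / 2 / M * M)); last by rewrite divfK// gt_eqF.
by apply: ler_pM; rewrite ?absK_ge0 ?HM// ltW.
Qed.

(* If [p] almost minimises the squared distance to [s] over [G], then [s - p],
   read as a combination of the [A i], almost separates [s] from [G]; testing
   on a finite net of such combinations suffices. *)
Lemma separation_net (N : nat) (eta : R) : 0 < eta -> exists (l : seq X) (e : R), 0 < e /\
  forall s G, polar U s -> CU U G ->
    (forall x, x \in l -> exists2 t, G t & absK (s x - t x) < e) ->
    exists2 p, G p & \sum_(0 <= i < N) absK (s (A i) - p (A i)) ^+ 2 < eta.
Proof.
move=> eta0.
have [D D0 HD] : exists2 D : R, 0 < D & forall i, (i < N)%N ->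
    forall s t, polar U s -> polar U t -> absK (s (A i) - t (A i)) <= D.
  elim: N => [|n [D D0 HD]]; first by exists 1.
  have [M M0 HM] := polar_bound U0 (A n).
  exists (D + 2 * M) => [|i]; first by lra.
  rewrite ltnS leq_eqVlt => /predU1P[->|i_n] s t Us Ut.
    have := absKD (s (A n)) (- t (A n)); rewrite absKN.
    have := HM _ Us; have := HM _ Ut; lra.
  by have := HD _ i_n _ _ Us Ut; lra.
pose q (s p : T) : R := \sum_(0 <= i < N) absK (s (A i) - p (A i)) ^+ 2.
have q_ge0 s p : 0 <= q s p by apply: sumr_ge0 => i _; exact: sqr_ge0.
pose B : R := N%:R * D ^+ 2 + 1.
have B0 : 0 < B by rewrite ltr_pwDr// mulr_ge0// sqr_ge0.
have qB s p : polar U s -> polar U p -> q s p <= B.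
  move=> Us Up; apply: (@le_trans _ _ (\sum_(0 <= i < N) D ^+ 2)).
    rewrite /q big_nat_cond [leRHS]big_nat_cond; apply: ler_sum => i.
    rewrite andbT => /andP[_ iN]; rewrite lerXn2r ?nnegrE ?absK_ge0 ?HD// ltW//.
  by rewrite sumr_const_nat subn0 -mulr_natl /B lerDl.
have eta16 : 0 < eta / 16 by rewrite divr_gt0.
have [l Hl] := @combination_net N D _ eta16.
exists l, (eta / 16); split; first by rewrite divr_gt0.
move=> s G Us CG HG.
have GU := CU_polar CG.
(* [lam] is the step from [p] towards a point of [G]: at most 1 to stay on the segment, and small
   enough to make the quadratic term negligible. *)
pose lam : R := Num.min 1 (eta / 2 / (1 + B)).
have B10 : 0 < 1 + B by lra.
have lam0 : 0 < lam by rewrite lt_min ltr01 !divr_gt0.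
have lam1 : lam <= 1 by rewrite ge_min lexx.
have lamB : lam * (1 + B) <= eta / 2.
  by rewrite -ler_pdivlMr// ge_min lexx orbT.
have has_q : has_inf [set q s p | p in G].
  split; first by have [p Gp] := CU_neq0 CG; exists (q s p); exists p.
  by exists 0 => _ [p _ <-].
have [_ [p Gp <-] qp] := inf_adherent (exprn_gt0 2 lam0) has_q.
have Up := GU _ Gp.
pose ip (t : T) : R :=
  \sum_(0 <= i < N) reK (conjK (s (A i) - p (A i)) * (t (A i) - p (A i))).
(* Since [q s p] is within [lam ^+ 2] of the infimum, the step lowers [q] by less than that; hence
   [2 * lam * ip t] is at most [lam ^+ 2 * (1 + B)]. *)
have ip_small t : G t -> ip t <= eta / 4.
  move=> Gt; have Ut := GU _ Gt.
  pose m : T := fun x => iK b lam * t x + (1 - iK b lam) * p x.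
  have Gm : G m.
    apply: CG.2.1 => //; rewrite -[X in X <= _ <= _](iK0 R b) -[X in _ <= _ <= X](iK1 R b).
    by rewrite !ler_iK ltW.
  have qm : q s m = q s p - 2 * lam * ip t + lam ^+ 2 * q t p.
    rewrite /q /ip !mulr_sumr -sumrB -big_split /=; apply: eq_bigr => i _.
    by rewrite -absK_subZ_sqr; congr (absK _ ^+ 2); rewrite /m; ring.
  have : inf [set q s p | p in G] <= q s m.
    by apply: ge_inf; [exact: has_q.2|exists m].
  rewrite qm => inf_m.
  have qtp := qB _ _ Ut Up.
  have : 2 * lam * ip t <= lam * (lam * (1 + B)).
    have : lam ^+ 2 * q t p <= lam ^+ 2 * B by rewrite ler_wpM2l// sqr_ge0.
    rewrite !expr2 in qp inf_m *; nra.
  rewrite -mulrA mulrCA ler_pM2l// => ?; lra.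
exists p => //; rewrite -/(q s p).
have [i iN|x xl Hx] := Hl (fun i => conjK (s (A i) - p (A i))).
  by rewrite absK_conj HD.
have [t Gt st] := HG x xl; have Ut := GU _ Gt.
(* The left side is the real inner product of [s - p] with [s - t] over the first [N]
   coordinates. *)
have : q s p - ip t <= absK (\sum_(0 <= i < N) conjK (s (A i) - p (A i)) * s (A i) -
    \sum_(0 <= i < N) conjK (s (A i) - p (A i)) * t (A i)).
  apply: le_trans (reK_le _); rewrite -sumrB /q /ip -sumrB.
  have reK_sum (f : nat -> K) : reK (\sum_(0 <= i < N) f i) = \sum_(0 <= i < N) reK (f i).
    by apply: (big_morph _ (@reKD R b) (reK0 R b)).
  rewrite reK_sum le_eqVlt; apply/orP; left; apply/eqP; apply: eq_bigr => i _.
  rewrite -reK_conjM.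
  have -> : forall a c : K, reK a - reK c = reK (a - c).
    move=> a c; apply/eqP; rewrite subr_eq -reKD; apply/eqP; congr reK; ring.
  congr reK; ring.
(* Replacing both combinations by values at [x] and comparing there costs three errors of
   [eta / 16], on top of [ip t <= eta / 4]. *)
have := absK_dist (\sum_(0 <= i < N) conjK (s (A i) - p (A i)) * s (A i)) (s x)
  (\sum_(0 <= i < N) conjK (s (A i) - p (A i)) * t (A i)).
have := absK_dist (s x) (t x) (\sum_(0 <= i < N) conjK (s (A i) - p (A i)) * t (A i)).
have := Hx _ Us; rewrite absKBC; have := Hx _ Ut; have := ip_small _ Gt; lra.
Qed.

Lemma dHA_small_dHaus_small (e : R) : 0 < e -> exists (l : seq X) (c : R), 0 < c /\
  forall F G, CU U F -> CU U G ->
    (forall x, x \in l -> (dHA x F G < c%:E)%E) -> dH F G < e.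
Proof.
move=> e0; have e20 : 0 < e / 2 by rewrite divr_gt0.
have [N [delta [delta0 Hd]]] := dmet_lt_of_coords U0 A e20.
(* A sum of squares below [delta ^+ 2] keeps every coordinate below [delta]. *)
have [l [c [c0 Hl]]] := separation_net N (exprn_gt0 2 delta0).
exists l, c; split=> // F G CF CG FG.
have H F' G' : CU U F' -> CU U G' ->
    (forall x, x \in l -> (dHA x F' G' < c%:E)%E) ->
    forall s, F' s -> exists2 t, G' t & d s t <= e / 2.
  move=> CF' CG' FG' s Fs; have Us := CU_polar CF' Fs.
  have [x xl|p Gp pq] := Hl _ _ Us CG'; first exact: dHA_ltP (FG' x xl) Fs.
  exists p => //; apply/ltW/Hd => //; first exact: CU_polar CG' _ Gp.
  move=> i iN; rewrite -(@ler_pXn2r _ 2) ?nnegrE ?absK_ge0 ?ltW//.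
  apply: le_lt_trans pq; rewrite (big_cat_nat _ iN)//= big_nat_recr//=.
  have P0 (m n : nat) : 0 <= \sum_(m <= j < n) absK (s (A j) - p (A j)) ^+ 2.
    by apply: sumr_ge0 => j _; exact: sqr_ge0.
  by have := P0 0 i; have := P0 i.+1 N; lra.
apply: (@le_lt_trans _ _ (e / 2)); last by lra.
by apply: dHaus_le => //; apply: H => // x xl; rewrite dHA_sym FG.
Qed.

End Hausdorff.

(** * Convergence of ultrafilters of closed convex sets *)

Section Hyperspace.
Variables (R : realType) (b : bool) (X : topologicalLmodType (Kfield R b)).
Local Notation K := (Kfield R b).
Local Notation T := {ptws X -> K}.
Variable U : set X.
Hypothesis U0 : nbhs (0 : X) U.
Variable A : nat -> X.
Hypothesis A_dense : dense (range A).
Local Notation d := (dmet A U).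
Local Notation dH := (dHaus A U).

Section PrimeFilter.
Variable Phi : set_system (set T).
Hypothesis PPhi : prime_filter Phi.
Hypothesis Phi_CU : Phi (CU U).

Let Phi_filter : ProperFilter Phi := PPhi.1.
Existing Instance Phi_filter.

(** This is the lower limit along [Phi]; it agrees with the upper limit because [Phi] is prime. *)
Definition kuratowski_lim : set T :=
  [set t | polar U t /\
    forall e : R, 0 < e -> Phi [set F | exists2 s, F s & d t s < e]].

Local Notation L := kuratowski_lim.

(** The image of a prime filter under any map is prime, so compactness of the polar applies to
    selections. *)
Lemma selection_cvg (sel : set T -> T) : Phi [set F | polar U (sel F)] ->
  exists2 t, polar U t & forall e : R, 0 < e -> Phi [set F | d t (sel F) < e].
Proof.
move=> selU; have [t Ut Ht] := polar_prime_cvg U0 A (prime_image sel PPhi) selU.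
by exists t => // e /Ht Hs; apply: (@filterS _ Phi _ _ _ _ Hs) => F [].
Qed.

Lemma selection_cvg_lim (sel : set T -> T) : Phi [set F | F (sel F)] ->
  exists2 t, L t & forall e : R, 0 < e -> Phi [set F | d t (sel F) < e].
Proof.
move=> selF; have [|t Ut Ht] := @selection_cvg sel.
  by apply: filterS2 selF Phi_CU => F Fs CF; exact: CU_polar CF _ Fs.
exists t => //; split=> // e e0; apply: filterS2 selF (Ht e e0) => F Fs ts.
by exists (sel F).
Qed.

Lemma lim_neq0 : L !=set0.
Proof.
(* Outside [CU U] the selection takes the default value [cst 0], which [Phi] does not see. *)
have /choice[sel Hsel] : forall F : set T, exists s, CU U F -> F s.
  move=> F; have [CF|nCF] := pselect (CU U F); last by exists (cst 0).
  by have [s Fs] := CU_neq0 CF; exists s.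
have [|t Lt _] := @selection_cvg_lim sel; last by exists t.
exact: filterS Phi_CU.
Qed.

Lemma lim_dclosed t : polar U t ->
  (forall e, 0 < e -> exists2 s, L s & d t s < e) -> L t.
Proof.
move=> Ut Ht; split=> // e e0; have e20 : 0 < e / 2 by rewrite divr_gt0.
have [s [Us Ls] ts] := Ht _ e20.
apply: filterS2 (Ls _ e20) Phi_CU => F [r Fr sr] CF; exists r => //.
by have := dmet_triangle U0 A Ut Us (CU_polar CF Fr); lra.
Qed.

Lemma polar_convex (s1 s2 : T) (t : K) : polar U s1 -> polar U s2 -> 0 <= t <= 1 ->
  polar U ((fun x => t * s1 x + (1 - t) * s2 x) : T).
Proof.
move=> U1 U2 /andP[t0 t1]; apply: linear_bounded_polar => // [a x y|x Ux].
  by rewrite (polar_lin U1) (polar_lin U2); ring.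
have absK_pos (z : K) : 0 <= z -> iK b (absK z) = z by move=> ?; rewrite iK_abs ger0_norm.
have tt : absK t + absK (1 - t) = 1.
  by apply: (@iK_inj _ b); rewrite iKD !absK_pos ?subr_ge0// iK1; ring.
apply: le_trans (absKD _ _) _; rewrite !absKM -tt.
apply: lerD; apply: ler_piMr; rewrite ?absK_ge0//; exact: polar_le1 Ux.
Qed.

(** Approximants taken in one and the same [F] combine inside [F], and [dmet_lin_le] bounds the
    resulting distance. *)
Lemma lim_convex : convexK L.
Proof.
move=> s1 s2 [U1 L1] [U2 L2] t t01; split; first exact: polar_convex.
have t_le1 (z : K) : 0 <= z <= 1 -> absK z <= 1.
  by move=> /andP[z0 z1]; rewrite -(ler_iK b) iK_abs iK1 ger0_norm.
have u01 : 0 <= 1 - t <= 1.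
  by case/andP: t01 => t0 t1; rewrite subr_ge0 t1 lerBlDr lerDl.
move=> e e0; have e20 : 0 < e / 2 by rewrite divr_gt0.
apply: filterS3 (L1 _ e20) (L2 _ e20) Phi_CU => F [r1 F1 d1] [r2 F2 d2] CF.
exists (fun x => t * r1 x + (1 - t) * r2 x); first exact: CF.2.1.
have V1 := CU_polar CF F1; have V2 := CU_polar CF F2.
apply: le_lt_trans (dmet_lin_le U0 A U1 U2 V1 V2 _ _) _; try exact: polar_convex.
have := dmet_ge0 U0 A U1 V1; have := dmet_ge0 U0 A U2 V2.
have := t_le1 _ t01; have := t_le1 _ u01.
have := absK_ge0 t; have := absK_ge0 (1 - t); nra.
Qed.

Lemma CU_lim : CU U L.
Proof.
split; first exact: lim_neq0; split; first exact: lim_convex.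
have LU : L `<=` polar U by move=> t [].
split=> //; exact: (dclosed_weakstar_closed U0 LU lim_dclosed).
Qed.

(** Otherwise [Phi]-almost every [F] contains a point at distance at least [e] from [L]; such a
    selection converges to a point of [L], a contradiction. *)
Lemma near_sub_lim (e : R) : 0 < e ->
  Phi [set F | forall s, F s -> exists2 t, L t & d s t < e].
Proof.
move=> e0; have [//|nPhi] := PPhi.2 [set F | forall s, F s -> exists2 t, L t & d s t < e].
have /choice[sel Hsel] : forall F : set T, exists s,
    ~ (forall s, F s -> exists2 t, L t & d s t < e) ->
    F s /\ forall t, L t -> ~ d s t < e.
  move=> F; have [?|/existsNP[s /not_implyP[Fs nL]]] :=
    pselect (forall s, F s -> exists2 t, L t & d s t < e); first by exists (cst 0).
  by exists s => _; split=> // t Lt ts; apply: nL; exists t.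
have [|t Lt Ht] := @selection_cvg_lim sel.
  by apply: filterS nPhi => F /Hsel[].
have [F [/Hsel[_ nF] tF]] := @filter_ex _ Phi _ _ (filterI nPhi (Ht e e0)).
by have := nF t Lt; rewrite dmet_sym.
Qed.

(** Otherwise select points of [L] far from [F]. They converge to some [t], which is in [L] by
    closedness and hence close to most [F], against the triangle inequality. *)
Lemma lim_sub_near (e : R) : 0 < e ->
  Phi [set F | forall t, L t -> exists2 s, F s & d t s < e].
Proof.
move=> e0; have [//|nPhi] := PPhi.2 [set F | forall t, L t -> exists2 s, F s & d t s < e].
have [t0 Lt0] := lim_neq0.
have /choice[sel Hsel] : forall F : set T, exists t, L t /\
    (~ (forall t, L t -> exists2 s, F s & d t s < e) ->
     forall s, F s -> ~ d t s < e).
  move=> F; have [?|/existsNP[t /not_implyP[Lt nF]]] :=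
    pselect (forall t, L t -> exists2 s, F s & d t s < e); first by exists t0.
  by exists t; split=> // _ s Fs ts; apply: nF; exists s.
have selU F : polar U (sel F) by have [[]] := Hsel F.
have [|t Ut Ht] := @selection_cvg sel; first exact: filterE.
have Lt : L t.
  apply: lim_dclosed => // c /Ht cPhi; have [F tF] := @filter_ex _ Phi _ _ cPhi.
  by exists (sel F) => //; have [] := Hsel F.
have e20 : 0 < e / 2 by rewrite divr_gt0.
have [F [[[nF tF] [s Fs ts]] CF]] := @filter_ex _ Phi _ _
  (filterI (filterI (filterI nPhi (Ht _ e20)) (Lt.2 _ e20)) Phi_CU).
have [_ /(_ nF s Fs) []] := Hsel F.
have := dmet_triangle U0 A (selU F) Ut (CU_polar CF Fs).
by move: tF; rewrite /= (dmet_sym _ _ t); lra.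
Qed.

Lemma CU_prime_cvg : exists2 F, CU U F &
  forall e : R, 0 < e -> Phi [set G | CU U G /\ dH F G < e].
Proof.
exists L; first exact: CU_lim.
move=> e e0; have e20 : 0 < e / 2 by rewrite divr_gt0.
apply: filterS3 Phi_CU (near_sub_lim e20) (lim_sub_near e20) => G CG GL LG.
split=> //; apply: (@le_lt_trans _ _ (e / 2)); last by lra.
apply: (dHaus_le U0 CU_lim CG) => s; first by move=> /LG[t Gt st]; exists t => //; exact: ltW.
by move=> /GL[t Lt st]; exists t => //; exact: ltW.
Qed.

End PrimeFilter.

(** * Agreement of the two topologies, compactness and completeness *)

Definition dHaus_open (O : set (set T)) :=
  forall F, O F -> exists r : R, 0 < r /\ [set G | CU U G /\ dH F G < r] `<=` O.

Lemma hyper_open_dHaus (O : set (set T)) : O `<=` CU U ->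
  hyper_open U O <-> dHaus_open O.
Proof.
move=> OU; split.
  move=> [_ HO] F OF; have [l [e [e0 sub]]] := HO F OF.
  have [r r0 Hr] := dHaus_small_dHA_small U0 A_dense l e0.
  exists r; split=> // G [CG FG]; apply: sub; split=> // x; apply: Hr => //.
  exact: OU.
move=> HO; split=> // F OF; have [r [r0 sub]] := HO F OF.
have [l [c [c0 Hl]]] := dHA_small_dHaus_small U0 A r0.
exists l, c; split=> // G [CG FG]; apply: sub; split=> //; apply: Hl => //.
exact: OU.
Qed.

Lemma hyper_open_ball F r : CU U F -> hyper_open U (hyper_ball A U F r).
Proof.
move=> CF; apply/hyper_open_dHaus => [G []//|G [CG FG]].
exists (r - dH F G); split; first by rewrite subr_gt0.
move=> H [CH GH]; split=> //; have := dHaus_triangle U0 A CF CG CH; lra.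
Qed.

(** Without a finite subcover, the complements of the [O i] in [CU U] lie in an ultrafilter. Its
    limit belongs to some [O i], which then meets its own complement. *)
Lemma CU_hyper_compact : hyper_compact (R := R) (b := b) U.
Proof.
move=> I O Oopen cover; apply: contrapT => nfin.
pose f (i : {classic I}) : set (set T) := CU U `\` O i.
pose D : set {classic I} := setT.
(* The empty subfamily covers an empty [CU U]; otherwise a member provides an index, through which
   [CU U] itself enters the ultrafilter. *)
have [C0|/set0P[F0 CF0]] := eqVneq (CU U : set (set T)) set0.
  by apply: nfin; exists set0; split; [exact: finite_set0|rewrite C0].
have finIf : finI D (fun i => f i).
  move=> D' _; apply: contrapT => /set0P/negP/negPn/eqP D'0.
  have [i0 _ _] := cover F0 CF0.
  apply: nfin; exists [set i : {classic I} | i \in D']; split.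
    exact: (@finite_fset _ D').
  move=> F CF; apply: contrapT => nF.
  suff : (\bigcap_(i in [set i | i \in D']) f i) F by rewrite D'0.
  by move=> i iD; split=> // OF; apply: nF; exists i.
have [Phi [UPhi sub]] := ultraFilterLemma (finI_filter finIf).
have PPhi := ultra_prime UPhi; have FPhi := PPhi.1.
have Phi_f i : Phi (f i) by apply: sub; exists (f i) => //; exact: finI_from1.
have [i0 _ _] := cover F0 CF0.
have Phi_CU : Phi (CU U) by apply: filterS (Phi_f i0) => F [].
have [F CF HF] := CU_prime_cvg PPhi Phi_CU.
have [i _ OF] := cover F CF.
have [/(_ (Oopen i) F OF) [r [r0 Hr]] _] := hyper_open_dHaus (Oopen i).1.
have [G [/Hr OG [_ nOG]]] := @filter_ex _ Phi _ _ (filterI (HF r r0) (Phi_f i)).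
exact: nOG.
Qed.

(** The limit of an ultrafilter containing all tails is a cluster point of the sequence, and a
    Cauchy sequence converges to its cluster points. *)
Lemma dHaus_complete (u : nat -> set T) : (forall n, CU U (u n)) ->
  (forall e : R, 0 < e -> exists N, forall p q, (N <= p)%N -> (N <= q)%N ->
     dH (u p) (u q) < e) ->
  exists L, CU U L /\
    forall e : R, 0 < e -> exists N, forall n, (N <= n)%N -> dH (u n) L < e.
Proof.
move=> uU cauchy.
have [Phi [UPhi sub]] := ultraFilterLemma (fmap_proper_filter u eventually_filter).
have PPhi := ultra_prime UPhi; have FPhi := PPhi.1.
have Phi_tail N : Phi [set F | exists2 n, (N <= n)%N & F = u n].
  by apply: sub; exists N => // n /= Nn; exists n.
have [|L CL HL] := CU_prime_cvg PPhi; first by apply: filterS (Phi_tail 0%N) => _ [n _ ->].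
exists L; split=> // e e0; have e20 : 0 < e / 2 by rewrite divr_gt0.
have [N HN] := cauchy _ e20; exists N => n Nn.
have [F [[_ Lk] [k Nk Fk]]] := @filter_ex _ Phi _ _ (filterI (HL _ e20) (Phi_tail N)).
have := HN n k Nn Nk; move: Lk; rewrite Fk dHaus_sym.
by have := dHaus_triangle U0 A (uU n) (uU k) CL; lra.
Qed.

Lemma CU_completely_metrizable : hyper_completely_metrizable (R := R) (b := b) U.
Proof.
exists dH; split; first by move=> F G; exact: dHaus_ge0.
split.
  move=> F G CF CG; split; first exact: dHaus_eq0.
  by move=> <-; exact: dHaus_self.
split; first by move=> F G _ _; exact: dHaus_sym.
split; first by move=> F G H; exact: dHaus_triangle.
split; [exact: hyper_open_dHaus|exact: dHaus_complete].
Qed.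

End Hyperspace.

Unset Implicit Arguments.

Theorem theorem3p17 (R : realType) (b : bool)
  (X : topologicalLmodType (Kfield R b)) (A : nat -> X) (U : set X) :
  hausdorff_space X ->
  dense (range A) ->
  (forall x y : X, x <> y -> exists s, @dual R b X s /\ s x <> s y) ->
  nbhs (0 : X) U ->
  (forall (U1 : set {ptws X -> Kfield R b}) (r : R), CU U U1 -> 0 < r ->
     hyper_open U (hyper_ball A U U1 r)) /\
  (forall O, hyper_open U O -> forall F, O F ->
     exists (U1 : set {ptws X -> Kfield R b}) (r : R),
       CU U U1 /\ 0 < r /\ hyper_ball A U U1 r F /\ hyper_ball A U U1 r `<=` O) /\
  hyper_compact U /\ hyper_completely_metrizable U.
Proof.
move=> _ A_dense _ U0; split; first by move=> F r CF _; exact: hyper_open_ball.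
split.
  move=> O Oopen F OF; have OU := Oopen.1.
  have [/(_ Oopen F OF) [r [r0 sub]] _] := hyper_open_dHaus U0 A_dense OU.
  (* The basic set around [F] is centred at [F] itself. *)
  exists F, r; split; first exact: OU.
  by split=> //; split=> //; split; [exact: OU|rewrite dHaus_self//; exact: OU].
by split; [exact: (CU_hyper_compact U0 A_dense)|
             exact: (CU_completely_metrizable U0 A_dense)].
Qed.
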